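(* For all integers $r\ge 3$ and $n\ge r+12$, \[ \log m(n,r) \le \frac{1}{n-r+1}\binom{n}{r}\log\bigl(\mathrm{e}(n-r+1)\bigr). \]
   Context: $m(n,r)$ denotes the number of matroids of rank $r$ on the ground set $[n]=\{1,\dots,n\}$. $\log$ is the logarithm to base $2$ and $\mathrm{e}$ is Euler's number. *)

(* Defs.v *)
From mathcomp Require Import all_boot.
From Stdlib Require Import Reals.
Set Implicit Arguments. Unset Strict Implicit. Unset Printing Implicit Defensive.

Definition basis_exchange (n : nat) (Bs : {set {set 'I_n}}) : bool :=
  [forall B1 in Bs, forall B2 in Bs, forall x in B1 :\: B2,
     exists y in B2 :\: B1, (y |: (B1 :\ x)) \in Bs].

Definition is_matroid_bases_of_rank (n r : nat) (Bs : {set {set 'I_n}}) : bool :=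
  [&& Bs != set0, [forall B in Bs, #|B| == r] & basis_exchange Bs].

Definition num_matroids (n r : nat) : nat :=
  #|[set Bs : {set {set 'I_n}} | is_matroid_bases_of_rank r Bs]|.

Definition log2 (x : R) : R := (ln x / ln 2)%R.

(* Main.v *)
Require Import Defs.
From mathcomp Require Import all_boot all_order all_algebra zify.
Set Implicit Arguments. Unset Strict Implicit. Unset Printing Implicit Defensive.

(** Let m'(n,r) count the matroids of rank r on n elements together with the
empty family of bases; adding the empty family makes the class closed under
contraction even when the contracted element is a loop. A family is determined
by its traces on the sets {B : e in B}, which cover every r-set r times, and
such a trace amounts to the contraction by e. Shearer's inequality therefore
gives m'(n,r)^r <= m'(n-1,r-1)^n, which reduces the theorem to rank 3.

In a simple rank 3 matroid, a line with k >= 2 points is recorded by k-2 of its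
triples, while it contains C(k,2) >= 3(k-2) of the n(n-1)/2 pairs, and each pair
lies on one line. So the matroid is encoded by at most n(n-1)/6 of the C(n,3)
triples, which gives at most (1+1/m)^C(n,3) m^(n(n-1)/6) of them, with m = n-2.
This is smaller than the bound B(n) = (e m)^(n(n-1)/6) by a constant factor.
A non-simple matroid is determined by the deletion of one element and by at most
n^2 further choices, so m'(n,3) <= #simple + n^2 m'(n-1,3), and m'(n,3) <= B(n)
follows by induction from n = 6. *)

(** * Superadditivity of geometric means and Shearer's inequality *)

Section Mahler.
Import Order.TTheory GRing.Theory Num.Theory.
Local Open Scope ring_scope.

(** In effect [X <= G^(1/d) a] and [Y <= G^(1/d) b] are added. Roots are avoided by assuming
    [X b <= Y a], whence [(X + Y) b <= Y (a + b) <= Y], and comparing [d]-th powers. *)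
Lemma exprD_le_convex (F : realFieldType) (d : nat) (X Y a b G : F) :
  (0 < d)%N -> 0 <= G -> 0 <= X -> 0 <= Y -> 0 <= a -> 0 <= b -> a + b <= 1 ->
  X ^+ d <= G * a ^+ d -> Y ^+ d <= G * b ^+ d -> (X + Y) ^+ d <= G.
Proof.
wlog le_XY : X Y a b / X * b <= Y * a => [H|] d0 G0 X0 Y0 a0 b0 ab hX hY.
  have [H1|/ltW H1] := leP (X * b) (Y * a); first exact: (H X Y a b).
  by rewrite addrC; apply: (H Y X b a) => //; rewrite addrC.
have a1 : a <= 1 by apply: le_trans ab; rewrite lerDl.
have Ga : G * a ^+ d <= G by rewrite ler_piMr // exprn_ile1.
have [bE | b_neq0] := eqVneq b 0.
  have Y_eq0 : Y = 0.
    apply/eqP; move: hY; rewrite bE expr0n gtn_eqF //= mulr0 => hY.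
    by have := expf_eq0 Y d; rewrite eq_le hY exprn_ge0 // d0 /= => <-.
  by rewrite Y_eq0 addr0; apply: le_trans hX Ga.
have b_gt0 : 0 < b by rewrite lt_def b_neq0.
rewrite -(ler_pM2r (exprn_gt0 d b_gt0)); apply: le_trans hY.
rewrite -exprMn lerXn2r ?nnegrE ?mulr_ge0 ?addr_ge0 //.
by rewrite mulrDl (le_trans (lerD le_XY (lexx _))) // -mulrDr ler_piMr.
Qed.

(** Mahler's inequality. AM-GM bounds the product over [P] of the ratios [x i / z i] by the
    [#|P|]-th power of their mean; the means for [x] and [y] sum to at most 1. Indices off [P] only
    need each ratio to be at most 1. *)
Lemma mahler_superadditive (I : finType) (P : {set I}) (x y z : I -> nat)
    (X Y : nat) :
  (0 < #|P|)%N ->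
  (forall i, i \in P -> (x i + y i <= z i)%N) ->
  (forall i, i \notin P -> (x i <= z i)%N && (y i <= z i)%N) ->
  (X ^ #|P| <= \prod_i x i)%N -> (Y ^ #|P| <= \prod_i y i)%N ->
  ((X + Y) ^ #|P| <= \prod_i z i)%N.
Proof.
set d := #|P| => d0 zP zNP hX hY.
pose G : rat := (\prod_i z i)%:R.
pose al (w : I -> nat) : rat := (\sum_(i in P) (w i)%:R / (z i)%:R) / d%:R.
have dR : (0 : rat) < d%:R by rewrite ltr0n.
have bound (w : I -> nat) W : (forall i, w i <= z i)%N ->
    (W ^ d <= \prod_i w i)%N -> 0 <= al w /\ W%:R ^+ d <= G * al w ^+ d.
  move=> wz hW; split.
    by rewrite divr_ge0 ?ler0n // sumr_ge0 // => i _; rewrite divr_ge0 ?ler0n.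
  have -> : G * al w ^+ d = (\prod_(i | i \notin P) (z i)%:R) *
      (\prod_(i in P) (z i)%:R * al w ^+ d).
    rewrite mulrA; congr (_ * _); rewrite /G natr_prod mulrC.
    by rewrite (bigID (mem P)).
  apply: le_trans (_ : (\prod_i w i)%:R <= _); first by rewrite -natrX ler_nat.
  rewrite natr_prod (bigID (mem P)) /= mulrC ler_pM ?prodr_ge0 //.
  - by apply: ler_prod => i _; rewrite ler0n ler_nat wz.
  - apply: le_trans (_ : \prod_(i in P) ((z i)%:R * ((w i)%:R / (z i)%:R)) <= _).
      apply: ler_prod => i _; rewrite ler0n /=.
      (* Division by [z i = 0] gives 0, which is harmless since [w i <= z i] then forces
         [w i = 0]. *)
      have [zi0|zi0] := eqVneq (z i) 0%N; last by rewrite mulrCA divff ?mulr1 ?pnatr_eq0.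
      by have := wz i; rewrite zi0 leqn0 => /eqP->; rewrite !(mul0r, mulr0).
    rewrite big_split ler_wpM2l ?prodr_ge0 //=.
    have H0 : {in P, forall i, 0 <= (w i)%:R / (z i)%:R :> rat}.
      by move=> i _; rewrite divr_ge0 ?ler0n.
    exact: (leif_AGM H0).1.
have xz i : (x i <= z i)%N.
  have [/zP|/zNP/andP[]//] := boolP (i \in P).
  by apply: leq_trans; rewrite leq_addr.
have yz i : (y i <= z i)%N.
  have [/zP|/zNP/andP[]//] := boolP (i \in P).
  by apply: leq_trans; rewrite leq_addl.
have [ax hx] := bound _ _ xz hX; have [ay hy] := bound _ _ yz hY.
rewrite -(ler_nat rat) natrX natrD.
apply: (@exprD_le_convex _ d X%:R Y%:R (al x) (al y)) => //; rewrite ?ler0n //.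
rewrite -mulrDl ler_pdivrMr // mul1r -big_split /= -[d in d%:R]sum1_card natr_sum.
apply: ler_sum => i iP; rewrite -mulrDl -natrD.
have [zi0|zi0] := posnP (z i); first by rewrite zi0 invr0 mulr0.
by rewrite ler_pdivrMr ?ltr0n // mul1r ler_nat zP.
Qed.

End Mahler.

(* Induction on [D]: splitting [F] according to the membership of [w] in [D] adds
   up the traces with [w \in S i], so that [mahler_superadditive] applies. *)
Lemma shearer_counting (T I : finType) (S : I -> {set T}) (d : nat)
    (D : {set T}) (F : {set {set T}}) :
  0 < d -> (forall w, w \in D -> #|[set i | w \in S i]| = d) ->
  {in F &, forall A B : {set T}, A :\: D = B :\: D} ->
  #|F| ^ d <= \prod_i #|[set A :&: S i | A in F]|.
Proof.
move=> d0; have [k] := ubnP #|D|; elim: k => // k IH in D F * => ltDk deg agree.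
have [->|[A0 A0F]] := set_0Vmem F; first by rewrite cards0 exp0n.
have [D0|[w wD]] := set_0Vmem D.
  have -> : F = [set A0].
    apply/setP=> A; rewrite inE; apply/idP/eqP => [AF|->//].
    by have := agree _ _ AF A0F; rewrite D0 !setD0.
  rewrite cards1 exp1n big1 // => i _.
  by rewrite imset_set1 cards1.
pose F1 := [set A in F | w \in A]; pose F0 := [set A in F | w \notin A].
have cardF : #|F| = #|F1| + #|F0|.
  rewrite -(cardsID [set A : {set T} | w \in A] F).
  by congr (_ + _); apply: eq_card => A; rewrite !inE andbC.
have sub (F' : {set {set T}}) : F' \subset F -> 
  {in F' &, forall A B : {set T}, (w \in A) = (w \in B)} ->
  #|F'| ^ d <= \prod_i #|[set A :&: S i | A in F']|.
  move=> /subsetP F'F F'w; apply: (IH (D :\ w)).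
  - by rewrite -ltnS (leq_trans _ ltDk) // ltnS (cardsD1 w D) wD.
  - by move=> v /setD1P[_ /deg].
  move=> A B AF' BF'; apply/setP=> v; rewrite !inE.
  have [->|_] := eqVneq v w; first by rewrite (F'w _ _ AF' BF').
  by have /setP/(_ v) := agree _ _ (F'F _ AF') (F'F _ BF'); rewrite !inE.
have F1F : F1 \subset F by apply/subsetP=> A; rewrite inE => /andP[].
have F0F : F0 \subset F by apply/subsetP=> A; rewrite inE => /andP[].
have dP : #|[set i | w \in S i]| = d by exact: deg.
rewrite cardF -dP.
apply: (mahler_superadditive (x := fun i => #|[set A :&: S i | A in F1]|)
   (y := fun i => #|[set A :&: S i | A in F0]|)); rewrite ?dP //.
- move=> i; rewrite inE => wSi.
  have disj : [set A :&: S i | A in F1] :&: [set A :&: S i | A in F0] = set0.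
    apply/setP=> C; rewrite !inE; apply/negP.
    case/andP=> /imsetP[A AF ->] /imsetP[B BF] /setP/(_ w).
    by move: AF BF; rewrite !inE wSi !andbT => /andP[_ ->] /andP[_ /negbTE->].
  rewrite -cardsUI disj cards0 addn0.
  by rewrite subset_leq_card // subUset !imsetS.
- by move=> i _; rewrite !subset_leq_card // imsetS.
- by apply: sub => // A B; rewrite !inE => /andP[_ ->] /andP[_ ->].
- by apply: sub => // A B; rewrite !inE => /andP[_ /negbTE->] /andP[_ /negbTE->].
Qed.

(** * Families of sets with the exchange property *)

(** Besides the matroids of rank [r], given by their bases, this contains only [set0]; its
    cardinality is m'(n,r). *)
Definition exchange_families (n r : nat) : {set {set {set 'I_n}}} :=
  [set Bs : {set {set 'I_n}} | [forall B in Bs, #|B| == r] && basis_exchange Bs].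

Section ExchangeFamilies.
Variables n r : nat.
Implicit Types (Bs : {set {set 'I_n}}) (A B : {set 'I_n}).

Lemma exchange_familiesP Bs :
  reflect ((forall B, B \in Bs -> #|B| = r) /\
           (forall B1 B2 x, B1 \in Bs -> B2 \in Bs -> x \in B1 -> x \notin B2 ->
              exists y, [/\ y \in B2, y \notin B1 & y |: (B1 :\ x) \in Bs]))
          (Bs \in exchange_families n r).
Proof.
rewrite inE; apply: (iffP andP) => -[H1 H2]; split.
- by move=> B BBs; apply/eqP; apply: (forall_inP H1).
- move=> B1 B2 x B1s B2s xB1 xB2.
  have xD : x \in B1 :\: B2 by rewrite inE xB1 xB2.
  have /exists_inP[y] := forall_inP (forall_inP (forall_inP H2 _ B1s) _ B2s) x xD.
  by rewrite inE => /andP[yB1 yB2] H; exists y.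
- by apply/forall_inP => B /H1 ->.
- apply/forall_inP => B1 B1s; apply/forall_inP => B2 B2s.
  apply/forall_inP => x; rewrite inE => /andP[xB2 xB1].
  have [y [yB2 yB1 yBs]] := H2 _ _ _ B1s B2s xB1 xB2.
  by apply/exists_inP; exists y; rewrite // inE yB1.
Qed.

Lemma num_matroids_le : num_matroids n r <= #|exchange_families n r|.
Proof.
apply/subset_leq_card/subsetP => Bs; rewrite !inE.
by case/and3P=> _ -> ->.
Qed.

Lemma exchange_families_gt0 : 0 < #|exchange_families n r|.
Proof.
apply/card_gt0P; exists set0; apply/exchange_familiesP.
by split=> [B|B1 B2 x]; rewrite inE.
Qed.

(** A crude bound, used on 5 points to start the rank 3 induction. *)
Lemma card_exchange_families_le : #|exchange_families n r| <= 2 ^ 'C(n, r).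
Proof.
have -> : 'C(n, r) = #|[set B : {set 'I_n} | #|B| == r]|.
  have := @cards_draws _ [set: 'I_n] r; rewrite cardsT card_ord => <-.
  by apply: eq_card => B; rewrite !inE subsetT.
rewrite -card_powerset; apply/subset_leq_card/subsetP => Bs.
case/exchange_familiesP => H _; rewrite powersetE; apply/subsetP => B /H BE.
by rewrite inE BE.
Qed.

(* Dual exchange in the only case needed: a member of [Bs] that contains [y] and
   has a largest intersection with [B] must be [B - x + y]. *)
Lemma exchange_parallel Bs x y B B' : Bs \in exchange_families n r ->
  (forall C, C \in Bs -> ~~ ((x \in C) && (y \in C))) ->
  B \in Bs -> x \in B -> B' \in Bs -> y \in B' -> y |: (B :\ x) \in Bs.
Proof.
case/exchange_familiesP=> cardBs exch xy BBs xB B'Bs yB'.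
pose P C := (C \in Bs) && (y \in C).
have PB' : P B' by rewrite /P B'Bs.
have [C /andP[CBs yC] Cmax] := arg_maxnP (fun C => #|C :&: B|) PB'.
have xC : x \notin C by have := xy _ CBs; rewrite yC andbT.
have yB : y \notin B by have := xy _ BBs; rewrite xB.
(* Another element [z] of [C] outside [B] could be exchanged for an element of [B], keeping [y] and
   enlarging the intersection. *)
have [z /andP[/andP[zy zC] zB]|noz] := pickP [pred z | (z != y) && (z \in C) && (z \notin B)].
  have [w [wB wC wBs]] := exch _ _ _ CBs BBs zC zB.
  have := Cmax (w |: (C :\ z)); rewrite /P wBs !inE (eq_sym y z) zy yC orbT => /(_ isT).
  have -> : (w |: C :\ z) :&: B = w |: (C :&: B).
    apply/setP=> v; rewrite !inE.
    have [->|_] /= := eqVneq v w; first by rewrite wB.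
    by have [->|] /= := eqVneq v z; rewrite // (negbTE zB) andbF.
  by rewrite cardsU1 !inE (negbTE wC) /= add1n ltnn.
suff -> : y |: (B :\ x) = C by [].
apply/esym/eqP; rewrite eqEcard; apply/andP; split.
  apply/subsetP=> v vC; rewrite !inE; have := noz v; rewrite /= vC andbT.
  have [//|/= _ /negbFE->] := eqVneq v y; rewrite andbT.
  by apply: contraNneq xC => <-.
rewrite cardsU1 !inE (negbTE yB) andbF (cardBs _ CBs) -(cardBs _ BBs).
by rewrite (cardsD1 x B) xB.
Qed.

End ExchangeFamilies.

(** * Contraction, deletion and the reduction of the rank *)

Lemma lift_imset_notin n (e : 'I_n.+1) (C : {set 'I_n}) : e \notin lift e @: C.
Proof. by apply/imsetP => -[i _ /eqP]; rewrite (negbTE (neq_lift _ _)). Qed.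

Lemma lift_imsetK n (e : 'I_n.+1) (B : {set 'I_n.+1}) :
  lift e @: (lift e @^-1: B) = B :\ e.
Proof.
apply/setP=> i; rewrite !inE; apply/imsetP/andP => [[j]|[ie iB]].
  by rewrite inE => jB ->; rewrite eq_sym neq_lift.
have [j ij|ij] := unliftP e i; last by rewrite ij eqxx in ie.
by exists j; rewrite // inE -ij.
Qed.

Lemma lift_exchange n (e : 'I_n.+1) (C : {set 'I_n}) x y :
  lift e @: (y |: C :\ x) = lift e y |: (lift e @: C :\ lift e x).
Proof.
rewrite imsetU1; congr (_ |: _); apply/setP=> v; rewrite !inE.
apply/imsetP/andP => [[u /setD1P[ux uC] ->]|[vx /imsetP[u uC vE]]].
  by rewrite (inj_eq (@lift_inj _ e)) ux imset_f.
by exists u; rewrite // !inE uC andbT -(inj_eq (@lift_inj _ e)) -vE.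
Qed.

(** [lift e] identifies ['I_n] with the complement of [e]. If no member contains [e], the result is
    [set0], unlike the matroid contraction of a loop. *)
Definition contraction n (e : 'I_n.+1) (Bs : {set {set 'I_n.+1}}) : {set {set 'I_n}} :=
  [set C : {set 'I_n} | e |: lift e @: C \in Bs].

Definition deletion n (e : 'I_n.+1) (Bs : {set {set 'I_n.+1}}) : {set {set 'I_n}} :=
  [set C : {set 'I_n} | lift e @: C \in Bs].

(** Both members contain [e], so the element exchanged in is not [e] and the exchange pulls back
    along [lift e]. *)
Lemma contraction_exchange n r e (Bs : {set {set 'I_n.+1}}) :
  Bs \in exchange_families n.+1 r.+1 ->
  contraction e Bs \in exchange_families n r.
Proof.
case/exchange_familiesP=> cardBs exch; apply/exchange_familiesP; split.
  move=> C; rewrite inE => /cardBs.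
  by rewrite cardsU1 lift_imset_notin (card_imset _ (@lift_inj _ e)) => -[].
move=> C1 C2 x; rewrite !inE => C1s C2s xC1 xC2.
have memU (C : {set 'I_n}) z : (lift e z \in e |: lift e @: C) = (z \in C).
  by rewrite !inE eq_sym (negbTE (neq_lift _ _)) mem_imset //; apply: lift_inj.
have xB1 : lift e x \in e |: lift e @: C1 by rewrite memU.
have xB2 : lift e x \notin e |: lift e @: C2 by rewrite memU.
have [y [yC2 yC1 ys]] := exch _ _ _ C1s C2s xB1 xB2.
have [j yj|yj] := unliftP e y; last by rewrite yj setU11 in yC1.
rewrite yj !memU in yC1 yC2; exists j; split; rewrite // inE lift_exchange -yj.
suff <- : y |: (e |: lift e @: C1) :\ lift e x =
  e |: (y |: (lift e @: C1 :\ lift e x)) by [].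
apply/setP=> v; rewrite !inE orbCA; congr (_ || _).
by have [->|//] := eqVneq v e; rewrite neq_lift.
Qed.

Lemma deletion_exchange n r e (Bs : {set {set 'I_n.+1}}) :
  Bs \in exchange_families n.+1 r ->
  deletion e Bs \in exchange_families n r.
Proof.
case/exchange_familiesP=> cardBs exch; apply/exchange_familiesP; split.
  by move=> C; rewrite inE => /cardBs; rewrite (card_imset _ (@lift_inj _ e)).
move=> C1 C2 x; rewrite !inE => C1s C2s xC1 xC2.
have memL (C : {set 'I_n}) z : (lift e z \in lift e @: C) = (z \in C).
  by rewrite mem_imset //; apply: lift_inj.
have xB1 : lift e x \in lift e @: C1 by rewrite memL.
have xB2 : lift e x \notin lift e @: C2 by rewrite memL.
have [y [yC2 yC1 ys]] := exch _ _ _ C1s C2s xB1 xB2.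
have [j yj|yj] := unliftP e y; last by rewrite yj (negbTE (lift_imset_notin _ _)) in yC2.
by rewrite yj !memL in yC1 yC2; exists j; split; rewrite // inE lift_exchange -yj.
Qed.

(** Shearer's inequality for the blocks [S e]: a set of size [r.+1] lies in [r.+1] of these [n.+1]
    blocks. *)
Lemma card_exchange_families_contraction n r :
  #|exchange_families n.+1 r.+1| ^ r.+1 <= #|exchange_families n r| ^ n.+1.
Proof.
pose S (e : 'I_n.+1) := [set B : {set 'I_n.+1} | e \in B].
pose D := [set B : {set 'I_n.+1} | #|B| == r.+1].
have deg B : B \in D -> #|[set e | B \in S e]| = r.+1.
  by rewrite inE => /eqP <-; apply: eq_card => e; rewrite !inE.
have agree : {in exchange_families n.+1 r.+1 &, forall Bs Bs' : {set {set 'I_n.+1}},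
    Bs :\: D = Bs' :\: D}.
  have noD Bs : Bs \in exchange_families n.+1 r.+1 -> Bs :\: D = set0.
    case/exchange_familiesP=> H _; apply/eqP; rewrite setD_eq0.
    by apply/subsetP=> B /H BE; rewrite inE BE.
  by move=> Bs Bs' /noD -> /noD ->.
apply: leq_trans (shearer_counting _ deg agree) _ => //.
rewrite -[X in _ <= _ ^ X]card_ord -prod_nat_const.
apply: leq_prod => e _.
(* [g] rebuilds the trace on [S e] from the contraction by [e], so there are no more traces than
   contractions. *)
pose g (Cs : {set {set 'I_n}}) := (fun C : {set 'I_n} => e |: lift e @: C) @: Cs.
apply: leq_trans (leq_imset_card g _); apply/subset_leq_card/subsetP => _ /imsetP[Bs BsE ->].
apply/imsetP; exists (contraction e Bs); first exact: contraction_exchange.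
apply/setP=> B; rewrite !inE; apply/andP/imsetP => [[BBs eB]|[C]].
  by exists (lift e @^-1: B); rewrite ?inE lift_imsetK setD1K.
by rewrite inE => CBs ->; rewrite CBs setU11.
Qed.

(** * Simple and non-simple families *)

(** The case [x = y] excludes loops, the case [x != y] parallel pairs. *)
Definition simple_family n (Bs : {set {set 'I_n}}) :=
  [forall x, forall y, exists B in Bs, (x \in B) && (y \in B)].

(* The family is recovered from the deletion of a loop [x] (encoded by the pair
   [(x, x)]), or from the deletion of [x] and an element [y] parallel to [x]. *)
Lemma card_nonsimple_le n r :
  #|[set Bs in exchange_families n.+1 r | ~~ simple_family Bs]| <=
    n.+1 ^ 2 * #|exchange_families n r|.
Proof.
pose g (p : 'I_n.+1 * 'I_n.+1 * {set {set 'I_n}}) : {set {set 'I_n.+1}} :=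
  let: (x, y, Cs) := p in
  let Bs := (fun C : {set 'I_n} => lift x @: C) @: Cs in
  if x == y then Bs else Bs :|: [set x |: (B :\ y) | B in Bs & y \in B].
have delE (x : 'I_n.+1) (Bs : {set {set 'I_n.+1}}) B : (B \in (fun C : {set 'I_n} => lift x @: C) @: deletion x Bs) =
    (B \in Bs) && (x \notin B).
  apply/imsetP/andP => [[C]|[BBs xB]].
    by rewrite inE => CBs ->; rewrite CBs lift_imset_notin.
  have BE : lift x @: (lift x @^-1: B) = B.
    by rewrite lift_imsetK; apply/setDidPl; rewrite disjoint_sym disjoints1.
  by exists (lift x @^-1: B); rewrite ?inE BE.
have -> : n.+1 ^ 2 * #|exchange_families n r| =
    #|setX [set: 'I_n.+1 * 'I_n.+1] (exchange_families n r)|.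
  by rewrite cardsX cardsT card_prod card_ord mulnn.
apply: leq_trans (leq_imset_card g _); apply/subset_leq_card/subsetP => Bs.
rewrite inE => /andP[BsE]; rewrite negb_forall => /existsP[x].
rewrite negb_forall => /existsP[y]; rewrite negb_exists => /forallP xy.
have {}xy B : B \in Bs -> ~~ ((x \in B) && (y \in B)).
  by move=> BBs; have := xy B; rewrite BBs.
have ginE p q Cs : Cs \in exchange_families n r -> Bs = g (p, q, Cs) ->
    Bs \in g @: setX [set: 'I_n.+1 * 'I_n.+1] (exchange_families n r).
  by move=> CsE ->; apply: imset_f; rewrite in_setX in_setT.
have loop z : (forall B, B \in Bs -> z \notin B) ->
    Bs \in g @: setX [set: 'I_n.+1 * 'I_n.+1] (exchange_families n r).
  move=> zB; apply: (ginE z z _ (deletion_exchange z BsE)).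
  rewrite /g eqxx; apply/setP=> B; rewrite delE.
  by case BBs: (B \in Bs) => /=; rewrite ?zB.
have [[Bx BxBs xBx]|nox] : (exists2 B, B \in Bs & x \in B) \/ (forall B, B \in Bs -> x \notin B).
- have [/exists_inP|] := boolP [exists B in Bs, x \in B]; first by left.
  by rewrite negb_exists_in => /forall_inP; right.
- have [[By ByBs yBy]|noy] : (exists2 B, B \in Bs & y \in B) \/ (forall B, B \in Bs -> y \notin B).
  + have [/exists_inP|] := boolP [exists B in Bs, y \in B]; first by left.
    by rewrite negb_exists_in => /forall_inP; right.
  + apply: (ginE x y _ (deletion_exchange x BsE)).
    have neq_xy : x != y.
      by apply: contraTneq xBx => xyE; have := xy _ BxBs; rewrite -xyE andbb.
    rewrite /g (negbTE neq_xy); apply/setP=> B; rewrite inE delE.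
    have [xB|xB] := boolP (x \in B); rewrite ?andbT ?andbF /=.
      (* [exchange_parallel] in both directions: replacing [x] by [y] turns members through [x] into
         members through [y], and conversely. *)
      apply/idP/imsetP => [BBs|[B']].
        exists (y |: (B :\ x)).
          rewrite inE delE !inE eqxx (negbTE neq_xy) /= andbT.
          by rewrite (exchange_parallel BsE xy BBs xB ByBs yBy) eqxx.
        have yB : y \notin B by have := xy _ BBs; rewrite xB.
        rewrite setU1K ?inE ?(negbTE yB) ?andbF //.
        by rewrite setD1K.
      rewrite inE delE -andbA => /and3P[B's xB' yB'] ->.
      apply: (exchange_parallel BsE _ B's yB' BxBs xBx) => C CBs.
      by rewrite andbC xy.
    have [//|/=] := boolP (B \in Bs); move=> _; apply/esym/negbTE/imsetP => -[B' _ BE].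
    by rewrite BE setU11 in xB.
  + exact: (loop y).
- exact: (loop x).
Qed.

(** * Encoding simple rank 3 matroids by few triples *)

(** Give each subset [U] of [X] the weight [m ^ (#|X| - #|U|)]. By the binomial theorem the total is
    [m.+1 ^ #|X|], and a [U] with at most [K] elements has weight at least [m ^ #|X| / m ^ K]. *)
Lemma card_bounded_subsets (T : finType) (X : {set T}) (m K : nat) : 0 < m ->
  #|[set U in powerset X | #|U| <= K]| * m ^ #|X| <= m.+1 ^ #|X| * m ^ K.
Proof.
move=> m0.
have -> : m.+1 ^ #|X| = \sum_(U in powerset X) m ^ (#|X| - #|U|).
  rewrite -addn1 expnDn; set N := #|X|.
  rewrite (partition_big (fun U : {set T} => inord #|U| : 'I_N.+1) xpredT) //=.
  apply: eq_bigr => i _; rewrite exp1n muln1.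
  rewrite (eq_bigr (fun=> m ^ (N - i))) => [|U /andP[]].
    rewrite sum_nat_const -cards_draws; congr (_ * _); apply: eq_card => U.
    rewrite !inE -topredE /= powersetE; have [UX|//] := boolP (U \subset X).
    by rewrite /= -val_eqE /= inordK // ltnS subset_leq_card.
  rewrite powersetE => UX /eqP <-.
  by rewrite inordK // ltnS subset_leq_card.
rewrite big_distrl /= -sum_nat_const.
rewrite [leqRHS](bigID (fun U : {set T} => #|U| <= K)) /=.
apply: leq_trans (leq_addr _ _).
rewrite (eq_bigl (fun U => (U \in powerset X) && (#|U| <= K))) => [|U]; last by rewrite !inE.
apply: leq_sum => U /andP[]; rewrite powersetE => UX UK.
rewrite -expnD leq_pexp2l // addnC -addnBCA ?leq_addr //; last exact: subset_leq_card.
Qed.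

Lemma leq_card_bigcup (I T : finType) (P : {set I}) (F : I -> {set T}) :
  #|\bigcup_(i in P) F i| <= \sum_(i in P) #|F i|.
Proof.
elim/big_rec2: _ => [|i A k _ IH]; first by rewrite cards0.
by rewrite (leq_trans (leq_card_setU _ _)) // leq_add2l.
Qed.

(** For [k >= 2] the difference is [(k - 3)(k - 4) / 2], which is nonnegative at integers. *)
Lemma leq_mul3_bin2 k : 3 * (k - 2) <= 'C(k, 2).
Proof.
case: k => [|[|[|k]]] //; rewrite subSS subSS subn0 !binS !bin1 !bin0.
by rewrite !(mulSn, mul0n, addn0) !addnA; lia.
Qed.

Section Lines.
Variable n : nat.
Implicit Types (Bs U : {set {set 'I_n}}) (A B L : {set 'I_n}).

(** For a pair [A] in a simple family of rank 3 this is the closure of [A]. It contains [A], since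
    [c |: A] has only two elements for [c] in [A]. *)
Definition line Bs A := [set c | c |: A \notin Bs].

Definition pairs : {set {set 'I_n}} := [set A : {set 'I_n} | #|A| == 2].

(** The default [set0] is never reached when [L] is the line of a pair. *)
Definition spanning_pair Bs L :=
  odflt set0 [pick A : {set 'I_n} | (A \in pairs) && (line Bs A == L)].

Definition line_code Bs : {set {set 'I_n}} :=
  \bigcup_(L in line Bs @: pairs)
    [set c |: spanning_pair Bs L | c in L :\: spanning_pair Bs L].

(** The code does not tell which pairs were chosen, so all pairs are tried. For a pair that was not
    chosen, the rebuilt set is still only a part of its line. *)
Definition line_decode U : {set {set 'I_n}} :=
  [set B : {set 'I_n} | (#|B| == 3) &&
     ~~ [exists A in pairs, B \subset A :|: [set c | c |: A \in U]]].

Section OneFamily.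
Variable Bs : {set {set 'I_n}}.
Hypothesis BsE : Bs \in exchange_families n 3.
Hypothesis simpleBs : simple_family Bs.

(** A line has rank 2: simplicity extends [A] to a basis [e |: A], and exchanging [e] against [B]
    yields a basis [y |: A] with [y] in [B], so [y] is off the line. *)
Lemma basis_not_sub_line A B : A \in pairs -> B \in Bs -> ~~ (B \subset line Bs A).
Proof.
have [cardBs exch] := exchange_familiesP _ _ BsE.
rewrite inE => Apair BBs; apply/negP => /subsetP BA.
have /cards2P[a [b [_ AE]]] := Apair.
have /forallP/(_ a)/forallP/(_ b)/exists_inP[C CBs /andP[aC bC]] := simpleBs.
have AC : A \subset C by rewrite AE subUset !sub1set aC.
have /cards1P[e CA] : #|C :\: A| == 1.
  by rewrite cardsD (setIidPr AC) (cardBs _ CBs) (eqP Apair).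
have CE : C = e |: A by rewrite -CA -[LHS](setID _ A) (setIidPr AC) setUC.
have : e \in C :\: A by rewrite CA set11.
rewrite inE => /andP[eA eC].
have eB : e \notin B by apply/negP=> /BA; rewrite inE -CE CBs.
have [y [/BA + _]] := exch _ _ _ CBs BBs eC eB.
by rewrite inE CE setU1K // => /negbTE->.
Qed.

Lemma sub_line A : A \in pairs -> A \subset line Bs A.
Proof.
have [cardBs _] := exchange_familiesP _ _ BsE.
rewrite inE => /eqP Apair; apply/subsetP=> c cA; rewrite inE (setUidPr _) ?sub1set //.
by apply/negP=> /cardBs; rewrite Apair.
Qed.

(** If [c] is on the line of [A], then [c |: A'] lies in that line and is no basis, so [c] is on the
    line of [A']. Hence [A] lies in the line of [A'], and the argument reverses. *)
Lemma line_eq A A' : A \in pairs -> A' \in pairs -> A' \subset line Bs A ->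
  line Bs A' = line Bs A.
Proof.
have sub C C' : C \in pairs -> C' \in pairs -> C' \subset line Bs C ->
    line Bs C \subset line Bs C'.
  move=> CP _ sCC'; apply/subsetP=> c cC; rewrite inE.
  by apply: contraL (_ : c |: C' \subset line Bs C) => [/basis_not_sub_line->//|];
    rewrite subUset sub1set cC.
move=> AP A'P AA'; apply/eqP; rewrite eqEsubset (sub A A') // andbT.
by apply: (sub A' A) => //; apply: subset_trans (sub A A' _ _ _) => //; apply: sub_line.
Qed.

Lemma spanning_pairP A : A \in pairs ->
  spanning_pair Bs (line Bs A) \in pairs /\
  line Bs (spanning_pair Bs (line Bs A)) = line Bs A.
Proof.
rewrite /spanning_pair => AP; case: pickP => [C /andP[CP /eqP]//|/(_ A)].
by rewrite AP eqxx.
Qed.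

Lemma line_code_triples : line_code Bs \subset [set B : {set 'I_n} | #|B| == 3].
Proof.
apply/bigcupsP=> _ /imsetP[A AP ->]; apply/subsetP=> _ /imsetP[c + ->].
have [+ _] := spanning_pairP AP; rewrite !inE => /eqP rA /andP[cA _].
by rewrite cardsU1 cA rA.
Qed.

Lemma line_codeK : line_decode (line_code Bs) = Bs.
Proof.
have [cardBs _] := exchange_familiesP _ _ BsE.
apply/setP=> B; rewrite inE; have [B3|B3] /= := eqVneq #|B| 3; last first.
  by apply/esym/negbTE; apply: contraNN B3 => /cardBs ->.
(* Every triple in the code is a non-basis, whichever pair it is read from. *)
have codeP (A : {set 'I_n}) c : A \in pairs -> c |: A \in line_code Bs -> c \in line Bs A.
  move=> AP /bigcupP[_ /imsetP[C CP ->] /imsetP[d]].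
  have [_ rE] := spanning_pairP CP; move=> /setDP[dC _] AE.
  by rewrite inE AE; move: dC; rewrite -{1}rE inE.
apply/idP/idP => [|BBs]; last first.
  apply/negP=> /exists_inP[A AP /subsetP sB].
  have /negP[] := basis_not_sub_line AP BBs; apply/subsetP=> c /sB /setUP[cA|].
    exact: (subsetP (sub_line AP)).
  by rewrite inE => /codeP; apply.
(* A non-basis triple lies on the line of any two of its points, and the chosen pair of that line
   recovers the whole line. *)
apply: contraNT => BBs; have [b bB] : exists b, b \in B by apply/card_gt0P; rewrite B3.
have BbP : B :\ b \in pairs by rewrite inE; move: B3; rewrite (cardsD1 b) bB add1n => -[->].
have sB : B \subset line Bs (B :\ b).
  rewrite -(setD1K bB) subUset sub1set setD1K // inE setD1K // BBs.
  exact: sub_line.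
have [rP rE] := spanning_pairP BbP.
apply/exists_inP; exists (spanning_pair Bs (line Bs (B :\ b))) => //.
apply/subsetP=> c /(subsetP sB) cL; rewrite !inE -implyNb; apply/implyP => cr.
apply/bigcupP; exists (line Bs (B :\ b)); first exact: imset_f.
by apply: imset_f; rewrite inE cr.
Qed.

(** Double counting: a line with [k] points costs at most [k - 2] triples and receives all its
    ['C(k, 2)] pairs, each of which spans only this line by [line_eq]. *)
Lemma card_line_code : #|line_code Bs| <= (n * n.-1) %/ 6.
Proof.
rewrite leq_divRL // mulnC -[6]/(2 * 3) -mulnA.
have -> : n * n.-1 = 2 * 'C(n, 2) by rewrite -mul_bin_diag bin1.
rewrite leq_mul2l /=.
have -> : 'C(n, 2) = #|pairs|.
  by rewrite -[n in LHS]card_ord -cardsT -cards_draws; apply: eq_card => B; rewrite !inE subsetT.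
rewrite -sum1_card (partition_big_imset (line Bs)) /=.
apply: leq_trans (leq_mul (leqnn 3) (leq_card_bigcup _ _)) _.
rewrite big_distrr /=; apply: leq_sum => _ /imsetP[A AP ->].
have [rP rE] := spanning_pairP AP.
set L := line Bs A in rP rE *; set R := spanning_pair Bs L in rP rE *.
apply: leq_trans (_ : 'C(#|L|, 2) <= _).
  have RL : R \subset L by rewrite -rE sub_line.
  apply: leq_trans (leq_mul (leqnn 3) (leq_imset_card _ _)) _.
  rewrite cardsD (setIidPr RL); move: rP; rewrite inE => /eqP->.
  exact: leq_mul3_bin2.
rewrite -cards_draws sum1dep_card; apply/subset_leq_card/subsetP => B.
rewrite !inE => /andP[BL B2]; rewrite B2 /=; apply/eqP.
by apply: line_eq => //; rewrite inE.
Qed.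
End OneFamily.

Lemma card_simple_rank3 (m : nat) : 0 < m ->
  #|[set Bs in exchange_families n 3 | simple_family Bs]| * m ^ 'C(n, 3) <=
    m.+1 ^ 'C(n, 3) * m ^ ((n * n.-1) %/ 6).
Proof.
move=> m0; set E := [set Bs in _ | _].
have T3 : 'C(n, 3) = #|[set B : {set 'I_n} | #|B| == 3]|.
  by rewrite -[n in LHS]card_ord -cardsT -cards_draws; apply: eq_card => B; rewrite !inE subsetT.
rewrite T3; apply: leq_trans (card_bounded_subsets _ _ m0); rewrite leq_mul2r.
apply/orP; right.
have -> : #|E| = #|line_code @: E|.
  apply/esym/card_in_imset => Bs Bs'; rewrite ![_ \in E]inE => /andP[H1 H2] /andP[H1' H2'] eq_code.
  by rewrite -(line_codeK H1 H2) eq_code line_codeK.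
apply/subset_leq_card/subsetP => _ /imsetP[Bs + ->]; rewrite inE => /andP[H1 H2].
by rewrite inE powersetE line_code_triples // card_line_code.
Qed.
End Lines.

(* Numerical estimates and the induction in rank 3 *)
From Stdlib Require Import Reals Lra.

Lemma INR_leq (a b : nat) : a <= b -> (INR a <= INR b)%R.
Proof. by move/leP; apply: le_INR. Qed.

Lemma INR_addn (a b : nat) : INR (a + b) = (INR a + INR b)%R.
Proof. exact: plus_INR. Qed.

Lemma INR_muln (a b : nat) : INR (a * b) = (INR a * INR b)%R.
Proof. exact: mult_INR. Qed.

Lemma INR_expn (a b : nat) : INR (expn a b) = (INR a ^ b)%R.
Proof. by elim: b => // b IH; rewrite expnS INR_muln IH. Qed.

Lemma ln_le_compat (x y : R) : (0 < x)%R -> (x <= y)%R -> (ln x <= ln y)%R.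
Proof.
by move=> x0 [xy|->]; [apply/Rlt_le/ln_increasing | apply: Rle_refl].
Qed.

Lemma ln_div (x y : R) : (0 < x)%R -> (0 < y)%R -> (ln (x / y) = ln x - ln y)%R.
Proof.
by move=> x0 y0; rewrite ln_mult ?ln_Rinv //; apply: Rinv_0_lt_compat.
Qed.

Lemma pow_exp_ln (x : R) (k : nat) : (0 < x)%R -> (x ^ k = exp (INR k * ln x))%R.
Proof. by move=> x0; rewrite -Rpower_pow. Qed.

(** The left side is the square of [1 + u / 2 <= exp (u / 2)]. *)
Lemma exp_quadratic_lower (u : R) : (0 <= u)%R -> (1 + u + u * u / 4 <= exp u)%R.
Proof.
move=> u0; replace u with (u / 2 + u / 2)%R at 4 by field.
rewrite exp_plus; have := exp_ineq1_le (u / 2)%R => H.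
by apply: Rle_trans (Rmult_le_compat _ _ _ _ _ _ H H); lra.
Qed.

Lemma ln_succ_div (m : R) : (5 <= m)%R -> (m * ln ((m + 1) / m) <= 1 - 1 / (5 * m))%R.
Proof.
move=> m5; have i0 : (0 < / m)%R by apply: Rinv_0_lt_compat; lra.
have i5 : (/ m <= / 5)%R by apply: Rinv_le_contravar; lra.
set i := (/ m)%R in i0 i5.
have im : (m * i = 1)%R by rewrite /i; field; lra.
have -> : ((m + 1) / m = 1 + i)%R by rewrite /i; field; lra.
(* Chosen so that [m * u] is the right-hand side; [1 + i <= exp u] then needs
   [(1 - i / 5)^2 / 4 >= 1 / 5], which holds as [i <= 1 / 5]. *)
pose u := (i - i * i / 5)%R.
have u0 : (0 <= u)%R by rewrite /u; nra.
have le_u : (1 + i <= exp u)%R.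
  apply: Rle_trans (exp_quadratic_lower u0).
  suff : (i * i * (1 - i / 5) * (1 - i / 5) / 4 >= i * i / 5)%R by rewrite /u; lra.
  have h1 : (24 / 25 * (24 / 25) <= (1 - i / 5) * (1 - i / 5))%R by nra.
  have h2 : (0 <= i * i)%R by nra.
  nra.
have : (ln (1 + i) <= u)%R.
  by rewrite -[X in (_ <= X)%R]ln_exp; apply: ln_le_compat => //; lra.
move=> H; replace (1 - 1 / (5 * m))%R with (m * u)%R.
  by apply: Rmult_le_compat_l => //; lra.
by rewrite /u /i; field; lra.
Qed.

(** From [exp 1 >= (1 + 1/16)^16]. The constant is large enough for its fifth power to exceed
    125. *)
Lemma exp1_lower : (263 / 100 <= exp 1)%R.
Proof.
replace 1%R with (INR 16 * / 16)%R by (rewrite /=; lra).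
have H := exp_ineq1_le (/ 16)%R.
rewrite -[(/ 16)%R]ln_exp -pow_exp_ln; last exact: exp_pos.
apply: Rle_trans (pow_incr (17 / 16) _ 16 _); last by lra.
by lra.
Qed.

Definition num_simple_rank3 (n : nat) : nat :=
  #|[set Bs in exchange_families n 3 | simple_family Bs]|.

Lemma card_exchange_families_rank3_rec n :
  #|exchange_families n.+1 3| <=
    num_simple_rank3 n.+1 + n.+1 * n.+1 * #|exchange_families n 3|.
Proof.
rewrite -(cardsID [set Bs | simple_family Bs] (exchange_families n.+1 3)).
apply: leq_add.
  by apply/subset_leq_card/subsetP => Bs; rewrite !inE.
apply: leq_trans (card_nonsimple_le n 3); apply/subset_leq_card/subsetP => Bs.
by rewrite !inE andbC.
Qed.

Lemma INR_num_simple_rank3 (n m : nat) : 0 < m ->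
  (INR (num_simple_rank3 n) * INR m ^ 'C(n, 3) <=
   INR m.+1 ^ 'C(n, 3) * INR m ^ ((n * n.-1) %/ 6))%R.
Proof.
by move=> m0; have := INR_leq (card_simple_rank3 n m0); rewrite !INR_muln !INR_expn.
Qed.

Lemma INR_bin3 (m : nat) :
  INR 'C(m.+2, 3) = ((INR m + 2) * (INR m + 1) / 6 * INR m)%R.
Proof.
have : 6 * 'C(m.+2, 3) = m.+2 * m.+1 * m.
  rewrite mulnC (bin_ffact m.+2 3 : _ * 6 = _) !ffactnSr ffactn0.
  by rewrite mul1n subn0 subn1 subn2.
by move/(congr1 INR); rewrite !INR_muln !S_INR /=; lra.
Qed.

(** This is B(n) = (e m)^(n(n-1)/6) for n = m + 2. *)
Definition rank3_bound (m : R) : R := exp ((m + 2) * (m + 1) / 6 * (1 + ln m)).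

Lemma num_simple_rank3_le (m : nat) : 5 <= m ->
  (INR (num_simple_rank3 m.+2) * (128 / 100) <= rank3_bound (INR m))%R.
Proof.
move=> m5; have mR : (5 <= INR m)%R by have := INR_leq m5; rewrite /=; lra.
set s := num_simple_rank3 _; set M := INR m in mR *.
pose k := ((M + 2) * (M + 1) / 6)%R.
have TE : INR 'C(m.+2, 3) = (k * M)%R by exact: INR_bin3.
have KE : (INR ((m.+2 * m.+1) %/ 6) <= k)%R.
  have := INR_leq (leq_trunc_div (m.+2 * m.+1) 6).
  by rewrite !INR_muln !S_INR -/M /k /=; lra.
set K := (_ %/ _) in KE.
have lnM : (0 <= ln M)%R by rewrite -ln_1; apply: ln_le_compat; lra.
have h : (INR s <= exp (INR 'C(m.+2, 3) * ln ((M + 1) / M) + INR K * ln M))%R.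
  have := @INR_num_simple_rank3 m.+2 m (leq_trans (isT : 0 < 5) m5).
  rewrite S_INR -/M -/s -/K => H.
  have MT : (0 < M ^ 'C(m.+2, 3))%R by apply: pow_lt; lra.
  apply: (Rmult_le_reg_r _ _ _ MT); apply: Rle_trans H _; apply: Req_le.
  rewrite !pow_exp_ln -?exp_plus; [|lra..].
  rewrite ln_div; [|lra..]; congr exp; ring.
have e1 : (INR 'C(m.+2, 3) * ln ((M + 1) / M) + INR K * ln M <=
    k * (1 + ln M) - 28 / 100)%R.
  have k0 : (0 <= k)%R by rewrite /k; nra.
  have a1 : (INR K * ln M <= k * ln M)%R by apply: Rmult_le_compat_r.
  have a2 : (k * (M * ln ((M + 1) / M)) <= k * (1 - 1 / (5 * M)))%R.
    by apply: Rmult_le_compat_l => //; apply: ln_succ_div.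
  (* Equality holds at [M = 5]. This gain in the exponent yields the factor
     [exp (28 / 100) >= 128 / 100]. *)
  have a3 : (28 / 100 <= k * (1 / (5 * M)))%R.
    rewrite /k; apply: (Rmult_le_reg_r (30 * M)); first lra.
    replace ((M + 2) * (M + 1) / 6 * (1 / (5 * M)) * (30 * M))%R
      with ((M + 2) * (M + 1))%R by (field; lra).
    nra.
  rewrite TE; nra.
have e2 : (exp (INR 'C(m.+2, 3) * ln ((M + 1) / M) + INR K * ln M) <=
    exp (k * (1 + ln M) - 28 / 100))%R.
  by case: e1 => [/exp_increasing/Rlt_le//|->]; apply: Rle_refl.
have e3 : (128 / 100 <= exp (28 / 100))%R.
  by have := exp_ineq1_le (28 / 100)%R; lra.
have -> : rank3_bound M = (exp (k * (1 + ln M) - 28 / 100) * exp (28 / 100))%R.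
  by rewrite -exp_plus /rank3_bound -/k; congr exp; ring.
apply: Rmult_le_compat => //; [exact: pos_INR | lra | exact: Rle_trans h e2].
Qed.

(** Bounds the non-simple contribution by a seventh of the bound. The two bounds differ by a factor
    of at least [exp 3 * M^2], while [7 (M + 2)^2 <= 13.72 M^2] for [M >= 5]. *)
Lemma rank3_bound_step (M : R) : (5 <= M)%R ->
  ((M + 2) * (M + 2) * rank3_bound (M - 1) * 7 <= rank3_bound M)%R.
Proof.
move=> M5.
have l1 : (/ M <= ln M - ln (M - 1))%R.
  have := exp_ineq1_le (ln ((M - 1) / M)); rewrite exp_ln; last first.
    by apply: Rdiv_lt_0_compat; lra.
  rewrite ln_div; [|lra..].
  replace ((M - 1) / M)%R with (1 - / M)%R by (field; lra); lra.
have lnM : (0 <= ln M)%R by rewrite -ln_1; apply: ln_le_compat; lra.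
have -> : rank3_bound M = (rank3_bound (M - 1) * exp ((M + 1) / 3 * (1 + ln M) +
   (M + 1) * M / 6 * (ln M - ln (M - 1))))%R.
  by rewrite -exp_plus; congr exp; field.
set a := rank3_bound (M - 1); have a0 : (0 < a)%R by apply: exp_pos.
suff : ((M + 2) * (M + 2) * 7 <= exp ((M + 1) / 3 * (1 + ln M) +
   (M + 1) * M / 6 * (ln M - ln (M - 1))))%R.
  by move/(Rmult_le_compat_l a _ _ (Rlt_le _ _ a0)); lra.
(* By [l1] the exponent is at least [(M + 1) / 2 + (M + 1) / 3 * ln M], and [M >= 5]. *)
apply: (@Rle_trans _ (exp (3 + (ln M + ln M)))); last first.
  have h : ((M + 1) * M / 6 * / M <= (M + 1) * M / 6 * (ln M - ln (M - 1)))%R.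
    by apply: Rmult_le_compat_l => //; nra.
  have E : ((M + 1) * M / 6 * / M = (M + 1) / 6)%R by field; lra.
  have le3 : (3 + (ln M + ln M) <= (M + 1) / 3 * (1 + ln M) +
      (M + 1) * M / 6 * (ln M - ln (M - 1)))%R.
    have h2 : (2 * ln M <= (M + 1) / 3 * ln M)%R by apply: Rmult_le_compat_r; lra.
    move: h; rewrite E; lra.
  by case: le3 => [/exp_increasing/Rlt_le//|->]; apply: Rle_refl.
rewrite (exp_plus 3) exp_plus exp_ln; last lra.
have e3 : (125 / 8 <= exp 3)%R.
  replace 3%R with (1 + (1 + 1))%R by lra; rewrite !exp_plus.
  have := exp1_lower; set e := exp 1 => e1.
  have e2 : (25 / 4 <= e * e)%R by nra.
  nra.
have q : (5 * M <= M * M)%R by apply: Rmult_le_compat_r; lra.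
have := Rmult_le_compat_r (M * M) _ _ ltac:(lra) e3; lra.
Qed.

(** Numerically, [(5/4)^20 * 4^5] simple families and [36 * 2^10] others stay below [1024 * 125]. *)
Lemma card_exchange_families_6 :
  (INR #|exchange_families 6 3| <= rank3_bound 4)%R.
Proof.
have := INR_leq (card_exchange_families_rank3_rec 5).
have := INR_leq (card_exchange_families_le 5 3).
have := @INR_num_simple_rank3 6 4 isT.
have -> : (6 * 6.-1) %/ 6 = 5 by [].
rewrite INR_expn INR_addn !INR_muln.
have -> : 'C(6, 3) = 20 by [].
have -> : 'C(5, 3) = 10 by [].
set s := INR (num_simple_rank3 6); set e5 := INR #|_|; set e6 := INR #|_|.
have -> : rank3_bound 4 = (1024 * exp 5)%R.
  rewrite /rank3_bound.
  replace ((4 + 2) * (4 + 1) / 6 * (1 + ln 4))%R with (5 + INR 5 * ln 4)%R by (rewrite /=; field).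
  by rewrite exp_plus -pow_exp_ln /=; lra.
have : (125 <= exp 5)%R.
  replace 5%R with (INR 5 * 1)%R by (rewrite /=; lra).
  rewrite -[X in (_ * X)%R]ln_exp -pow_exp_ln; last exact: exp_pos.
  by apply: Rle_trans (pow_incr (263 / 100) _ 5 _); have := exp1_lower; lra.
rewrite [INR 4]/= [INR 5]/= [INR 6]/= [INR 2]/=; lra.
Qed.

(** The induction closes because the simple part is at most 100/128 of the bound, the rest at most
    1/7, and these add up to less than 1. *)
Lemma card_exchange_families_rank3 (m : nat) : 4 <= m ->
  (INR #|exchange_families m.+2 3| <= rank3_bound (INR m))%R.
Proof.
elim: m => // m IH; rewrite leq_eqVlt => /predU1P[[<-]|m4].
  by have := card_exchange_families_6; rewrite /=; replace (1 + 1 + 1 + 1)%R with 4%R by lra.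
have mR : (5 <= INR m.+1)%R by have := INR_leq m4; rewrite /=; lra.
have := INR_leq (card_exchange_families_rank3_rec m.+2).
rewrite INR_addn !INR_muln.
have := num_simple_rank3_le m4; have := rank3_bound_step mR; have := IH m4.
have -> : (INR m.+3 = INR m.+1 + 2)%R by rewrite !S_INR; ring.
have -> : (INR m.+1 - 1 = INR m)%R by rewrite S_INR; ring.
set M := INR m.+1 in mR *; set s := INR (num_simple_rank3 _).
set b := rank3_bound M; set a := rank3_bound (INR m) => H1 H2 H3 H4.
have b0 : (0 < b)%R by apply: exp_pos.
have := Rmult_le_compat_l ((M + 2) * (M + 2)) _ _ ltac:(nra) H1.
lra.
Qed.

(** * Induction on the rank and conclusion *)

(** Contraction lowers [r] and keeps the corank [d], so the induction on [r] ends in rank 3, where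
    [m = n - 2 = d.+1]. *)
Lemma ln_card_exchange_families (d r : nat) : 3 <= d -> 3 <= r ->
  (ln (INR #|exchange_families (r + d) r|) <=
   / INR d.+1 * INR 'C(r + d, r) * (1 + ln (INR d.+1)))%R.
Proof.
move=> d3; elim: r => // r IH; rewrite leq_eqVlt => /predU1P[[<-]|r3].
  have pos := INR_leq (exchange_families_gt0 (3 + d) 3).
  have H := card_exchange_families_rank3 (d3 : 4 <= d.+1).
  have d0 : (0 < INR d.+1)%R by apply: lt_0_INR; apply/ltP.
  have -> : INR 'C(3 + d, 3) = ((INR d.+1 + 2) * (INR d.+1 + 1) / 6 * INR d.+1)%R.
    exact: INR_bin3.
  have {}H : (ln (INR #|exchange_families (3 + d) 3|) <=
      ln (rank3_bound (INR d.+1)))%R.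
    by apply: ln_le_compat => //; move: pos; rewrite /=; lra.
  apply: Rle_trans H _; rewrite ln_exp; apply: Req_le; field; lra.
have E0 a : (0 < INR #|exchange_families a r|)%R.
  by apply: lt_0_INR; apply/ltP; apply: exchange_families_gt0.
have E1 a : (0 < INR #|exchange_families a r.+1|)%R.
  by apply: lt_0_INR; apply/ltP; apply: exchange_families_gt0.
have := INR_leq (card_exchange_families_contraction (r + d) r).
rewrite -addSn !INR_expn !pow_exp_ln //.
set L1 := ln _; set L0 := ln _ => H.
have {}H : (INR r.+1 * L1 <= INR (r.+1 + d) * L0)%R.
  by rewrite -(ln_exp (_ * L1)) -(ln_exp (_ * L0)); apply: ln_le_compat => //; apply: exp_pos.
have r0 : (0 < INR r.+1)%R by apply: lt_0_INR; apply/ltP.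
apply: (Rmult_le_reg_l (INR r.+1)) => //; apply: Rle_trans H _.
(* By this identity the bound for rank [r] turns exactly into the bound for rank [r.+1]. *)
have := congr1 INR (mul_bin_diag (r.+1 + d) r); rewrite !INR_muln => bin.
replace (INR r.+1 * (/ INR d.+1 * INR 'C(r.+1 + d, r.+1) * (1 + ln (INR d.+1))))%R
  with (INR (r.+1 + d) * (/ INR d.+1 * INR 'C(r + d, r) * (1 + ln (INR d.+1))))%R.
  by apply: Rmult_le_compat_l; [exact: pos_INR | exact: IH].
transitivity (/ INR d.+1 * (1 + ln (INR d.+1)) * (INR (r.+1 + d) * INR 'C(r + d, r)))%R.
  by ring.
by rewrite bin; ring.
Qed.

Theorem theorem1p5 (n r : nat) :
  (3 <= r)%N -> (r + 12 <= n)%N ->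
  (log2 (INR (num_matroids n r))
   <= / INR (n - r + 1) * INR 'C(n, r) * log2 (exp 1 * INR (n - r + 1)))%R.
Proof.
move=> r3 rn; have rn' : r <= n by rewrite (leq_trans _ rn) ?leq_addr.
have d3 : 3 <= n - r by rewrite leq_subRL // (leq_trans _ rn) // leq_add2l.
have := ln_card_exchange_families d3 r3; rewrite subnKC // addn1 /log2 => H.
have d0 : (0 < INR (n - r).+1)%R by apply: lt_0_INR; apply/ltP.
rewrite ln_mult ?ln_exp //; last exact: exp_pos.
have ln2 : (0 < ln 2)%R by rewrite -ln_1; apply: ln_increasing; lra.
have -> : (/ INR (n - r).+1 * INR 'C(n, r) * ((1 + ln (INR (n - r).+1)) / ln 2) =
  (/ INR (n - r).+1 * INR 'C(n, r) * (1 + ln (INR (n - r).+1))) / ln 2)%R by field; lra.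
apply: Rmult_le_compat_r; first by apply/Rlt_le/Rinv_0_lt_compat.
apply: Rle_trans H.
(* [ln 0] is 0 by convention, so a zero count is treated apart from the monotonicity of [ln]. *)
have [n0|n0] := posnP (num_matroids n r).
  rewrite n0 /= {1}/ln; case: Rlt_dec => [/Rlt_irrefl//|_].
  rewrite -ln_1; apply: ln_le_compat; first lra.
  exact: INR_leq (exchange_families_gt0 n r).
apply: ln_le_compat; first by apply: lt_0_INR; apply/ltP.
exact: INR_leq (num_matroids_le n r).
Qed.
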